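(* If $z=e^{i\theta}$ and $a=\mathrm{diag}(i,\dots,i,-i,\dots,-i)$, then the $1$-soliton $g_{z,\pi}*0$ for the $-1$-flow $$(g^{-1}g_T)_T-(g^{-1}g_X)_X+[g^{-1}g_X,\,g^{-1}g_T]=[a,\,g^{-1}ag]$$ is periodic in time $T$ with period $\frac{2\pi}{\cos\theta}$. A multiple soliton generated by a rational loop with poles at $z_1=e^{i\theta_1},\dots,z_r=e^{i\theta_r}$ is periodic with period $\tau$ if there exist integers $k_1,\dots,k_r$ such that $$\tau=\frac{2\pi k_j}{\cos\theta_j}\qquad\text{for all }1\le j\le r.$$
   Context: The $-1$-flow here is the one defined by $b=a$: $u_t=[a,g^{-1}ag]$, where $g^{-1}g_x=u$ and $\lim_{x\to-\infty}g(x,t)=I$, for $u:\mathbb R^2\to\mathcal U_a^\perp$ with $u(\cdot,t)$ in the Schwartz class, where $\mathcal U_a^\perp$ is the orthogonal complement in $u(n)$ (trace form) of $\{y\in u(n):[a,y]=0\}$. In terms of $g$ it reads $(g^{-1}g_x)_t=[a,g^{-1}ag]$. The coordinates $(x,t)$ are characteristic; the space-time coordinates are $X=x-t$, $T=x+t$, in which the equation takes the form displayed in the claim. The trivialization of a solution $u$ is the solution $E(x,t,\lambda)$, $\lambda\in\mathbb C\setminus\{0\}$, of $E_x=E(a\lambda+u)$, $E_t=E\lambda^{-1}g^{-1}ag$, $E(0,0,\lambda)=I$; for $u=0$ it is $\exp(a(\lambda x+\lambda^{-1}t))$. $G_-^m$ is the group of rational maps (rational loops) $f$ from $S^2=\mathbb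 C\cup\{\infty\}$ to $GL(n,\mathbb C)$ (invertible off a finite set) with $f(\infty)=I$, $f(\bar\lambda)^*f(\lambda)=I$. It acts on solutions: factor $fE(x,t,\cdot)=\tilde E(x,t,\cdot)\tilde f(x,t,\cdot)$ with $\tilde f(x,t,\cdot)\in G_-^m$ and $\tilde E(x,t,\cdot)$ holomorphic and invertible on $\mathbb C\setminus\{0\}$ with $\tilde E(x,t,\bar\lambda)^*\tilde E(x,t,\lambda)=I$; then $f*u=\tilde u$ with $\tilde E^{-1}\tilde E_x=a\lambda+\tilde u$. For $z\in\mathbb C\setminus\mathbb R$ and a Hermitian projection $\pi$ of $\mathbb C^n$ ($\pi^*=\pi=\pi^2$), $g_{z,\pi}(\lambda)=\pi+\frac{\lambda-z}{\lambda-\bar z}(I-\pi)\in G_-^m$. The multiple soliton generated by a rational loop $f\in G_-^m$ is $f*0$, where $0$ is the vacuum solution. It is understood that $z,z_1,\dots,z_r$ are non-real and that the cosines in the denominators are nonzero.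
   Formalization: For the multiple soliton, the poles of the rational loop are assumed simple and no pole may be the conjugate of another; with a double pole (e.g. the loop g_{z,π}²) the claim fails, since terms linear in T appear. *)

(* Defs.v *)
From HB Require Import structures.
From mathcomp Require Import all_boot all_order all_algebra.
From mathcomp Require Import complex.
From mathcomp Require Import all_classical all_reals all_analysis.

Set Implicit Arguments.
Unset Strict Implicit.
Unset Printing Implicit Defensive.

Import Order.TTheory GRing.Theory Num.Theory numFieldNormedType.Exports.

Local Open Scope ring_scope.
Local Open Scope classical_set_scope.
Local Open Scope complex_scope.
Local Open Scope sesquilinear_scope.

(** [R[i]] carries no normed [R]-module structure, so calculus in a real
    variable is done on the real and imaginary parts of the entries. *)

Definition is_derive_mx (R : realType) (n : nat)
    (F : R -> 'M[R[i]]_n) (x : R) (D : 'M[R[i]]_n) : Prop :=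
  forall i j, is_derive x 1 (fun s => complex.Re (F s i j)) (complex.Re (D i j)) /\
              is_derive x 1 (fun s => complex.Im (F s i j)) (complex.Im (D i j)).

Definition cvg_ninfty_mx (R : realType) (n : nat)
    (F : R -> 'M[R[i]]_n) (L : 'M[R[i]]_n) : Prop :=
  forall i j,
    (complex.Re (F x i j) @[x --> -oo] --> complex.Re (L i j)) /\
    (complex.Im (F x i j) @[x --> -oo] --> complex.Im (L i j)).

Definition schwartz (R : realType) (h : R -> R) : Prop :=
  forall m : nat, (forall x, derivable (derive1n m h) x 1) /\
    forall k : nat, exists M : R, forall x, `|x ^+ k * derive1n m h x| <= M.

Definition schwartz_mx (R : realType) (n : nat) (F : R -> 'M[R[i]]_n) : Prop :=
  forall i j, schwartz (fun s => complex.Re (F s i j)) /\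
              schwartz (fun s => complex.Im (F s i j)).

Definition holomorphic_mx_at (R : realType) (n : nat)
    (F : R[i] -> 'M[R[i]]_n) (l : R[i]) : Prop :=
  forall i j, derivable ((fun w => F w i j) : R[i]^o -> R[i]^o) l 1.

Definition lie (R : realType) (n : nat) (A B : 'M[R[i]]_n) : 'M[R[i]]_n :=
  A *m B - B *m A.

Definition skew_hermitian (R : realType) (n : nat) (A : 'M[R[i]]_n) : Prop :=
  A ^t* = - A.

Definition diag_i (R : realType) (n k : nat) : 'M[R[i]]_n :=
  diag_mx (\row_(j < n) if (j < k)%N then 'i else - 'i).

(** The orthogonal complement in u(n), for the trace form, of the centralizer
    of [a] in u(n). *)
Definition centralizer_perp (R : realType) (n : nat)
    (a u : 'M[R[i]]_n) : Prop :=
  skew_hermitian u /\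
  forall y, skew_hermitian y -> lie a y = 0 -> \tr (u *m y) = 0.

Definition flow_frame (R : realType) (n : nat)
    (u g : R -> R -> 'M[R[i]]_n) : Prop :=
  forall t, [/\ forall x, g x t \in unitmx,
                forall x, is_derive_mx (fun s => g s t) x (g x t *m u x t) &
                cvg_ninfty_mx (fun x => g x t) 1%:M].

(** [u_t = [a, g^-1 a g]], where [g] is the frame of [u].  In the space-time
    coordinates [X = x - t], [T = x + t] this is the equation
    [(g^-1 g_T)_T - (g^-1 g_X)_X + [g^-1 g_X, g^-1 g_T] = [a, g^-1 a g]]. *)
Definition minus_one_flow (R : realType) (n : nat) (a : 'M[R[i]]_n)
    (u g : R -> R -> 'M[R[i]]_n) : Prop :=
  [/\ forall x t, centralizer_perp a (u x t),
      forall t, schwartz_mx (fun x => u x t),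
      flow_frame u g &
      forall x t, is_derive_mx (fun s => u x s) t
                    (lie a (invmx (g x t) *m a *m g x t))].

Definition trivialization (R : realType) (n : nat) (a : 'M[R[i]]_n)
    (u g : R -> R -> 'M[R[i]]_n) (E : R -> R -> R[i] -> 'M[R[i]]_n) : Prop :=
  forall l : R[i], l != 0 ->
    [/\ forall x t, is_derive_mx (fun s => E s t l) x
                      (E x t l *m (l *: a + u x t)),
        forall x t, is_derive_mx (fun s => E x s l) t
                      (E x t l *m (l^-1 *: (invmx (g x t) *m a *m g x t))) &
        E 0 0 l = 1%:M].

(** A rational map is a function [f : R[i] -> 'M_n] written in lowest terms
    as [N / d]; its poles are the roots of [d], where the value of [f] is
    irrelevant. *)

Definition reduced_fraction (R : realType) (n : nat)
    (f : R[i] -> 'M[R[i]]_n) (N : 'M[{poly R[i]}]_n) (d : {poly R[i]}) : Prop :=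
  [/\ d \is monic,
      forall l, root d l -> exists i j, (N i j).[l] != 0 &
      forall l, ~~ root d l -> f l = d.[l]^-1 *: map_mx (horner^~ l) N].

Definition rational_map (R : realType) (n : nat) (f : R[i] -> 'M[R[i]]_n) : Prop :=
  exists N d, reduced_fraction f N d.

Definition pole_order (R : realType) (n : nat)
    (f : R[i] -> 'M[R[i]]_n) (p : R[i]) (m : nat) : Prop :=
  exists N d, reduced_fraction f N d /\ mup p d = m.

Definition is_pole (R : realType) (n : nat)
    (f : R[i] -> 'M[R[i]]_n) (p : R[i]) : Prop :=
  exists m, pole_order f p m.+1.

Definition simple_pole (R : realType) (n : nat)
    (f : R[i] -> 'M[R[i]]_n) (p : R[i]) : Prop :=
  pole_order f p 1.

(** The group of rational loops; the value at infinity is read off in the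
    chart [w = 1 / l] of the sphere. *)
Definition rational_loop (R : realType) (n : nat)
    (f : R[i] -> 'M[R[i]]_n) : Prop :=
  [/\ rational_map f,
      exists s : seq R[i], forall l, l \notin s -> f l \in unitmx,
      forall i j, ((f w^-1 i j : R[i]^o) @[w --> (0 : R[i]^o)^'])
                    --> ((1%:M : 'M[R[i]]_n) i j : R[i]^o) &
      forall l, ~ is_pole f l -> ~ is_pole f (l^*)%R -> (f (l^*)%R) ^t* *m f l = 1%:M].

Definition hermitian_projection (R : realType) (n : nat)
    (p : 'M[R[i]]_n) : Prop :=
  p ^t* = p /\ p *m p = p.

Definition simple_element (R : realType) (n : nat) (z : R[i])
    (p : 'M[R[i]]_n) (l : R[i]) : 'M[R[i]]_n :=
  p + ((l - z) / (l - (z^*)%R)) *: (1%:M - p).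

(** [f * u = v]: [E] is the trivialization of [u] and [f E = E' f'] the
    factorization, an identity of meromorphic functions of [l], hence stated
    off the poles of [f] and [f']. *)
Definition dressing (R : realType) (n : nat) (a : 'M[R[i]]_n)
    (f : R[i] -> 'M[R[i]]_n) (u v : R -> R -> 'M[R[i]]_n) : Prop :=
  exists (g : R -> R -> 'M[R[i]]_n) (E E' f' : R -> R -> R[i] -> 'M[R[i]]_n),
  [/\ minus_one_flow a u g,
      trivialization a u g E,
      forall x t, rational_loop (f' x t) &
      [/\ forall x t l, l != 0 -> ~ is_pole f l -> ~ is_pole (f' x t) l ->
            f l *m E x t l = E' x t l *m f' x t l,
          forall x t l, l != 0 ->
            holomorphic_mx_at (E' x t) l /\ E' x t l \in unitmx,
          forall x t l, l != 0 -> (E' x t (l^*)%R) ^t* *m E' x t l = 1%:M &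
          forall x t l, l != 0 ->
            is_derive_mx (fun s => E' s t l) x
              (E' x t l *m (l *: a + v x t))]].

Definition vacuum (R : realType) (n : nat) : R -> R -> 'M[R[i]]_n :=
  fun _ _ => 0.

Definition soliton (R : realType) (n : nat) (a : 'M[R[i]]_n)
    (f : R[i] -> 'M[R[i]]_n) (u : R -> R -> 'M[R[i]]_n) : Prop :=
  dressing a f (@vacuum R n) u.

(** A function of the characteristic coordinates [(x, t)], read in the
    space-time coordinates [X = x - t], [T = x + t]. *)
Definition spacetime (R : realType) (V : Type) (w : R -> R -> V) (X T : R) : V :=
  w ((X + T) / 2) ((T - X) / 2).

Definition time_periodic (R : realType) (V : Type)
    (w : R -> R -> V) (tau : R) : Prop :=
  forall X T, spacetime w X (T + tau) = spacetime w X T.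

(** The flow may be read as an equation for [u] or for its frame [g]; both
    are required to be periodic. *)
Definition periodic_solution (R : realType) (n : nat)
    (u : R -> R -> 'M[R[i]]_n) (tau : R) : Prop :=
  time_periodic u tau /\ forall g, flow_frame u g -> time_periodic g tau.

Definition expi (R : realType) (theta : R) : R[i] := cos theta +i* sin theta.

(* Main.v *)
Require Import Defs.
From HB Require Import structures.
From mathcomp Require Import all_boot all_order all_algebra.
From mathcomp Require Import complex ring.
From mathcomp Require Import all_classical all_reals all_analysis.
Import Order.TTheory GRing.Theory Num.Theory numFieldNormedType.Exports.
Local Open Scope ring_scope.

Set Implicit Arguments.
Unset Strict Implicit.
Unset Printing Implicit Defensive.

(** The vacuum has frame [1] and the diagonal trivialization
    [E(x,t,l) = exp (a (l x + t / l))].  Advancing the time [T] by [tau] adds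
    [h = tau / 2] to both [x] and [t], and so multiplies [E] by
    [D(l) = exp (a (l + 1/l) h)], which depends neither on [x] nor on [t].

    At [l = exp (i theta)] one has [l + 1/l = 2 cos theta].  The condition on
    [tau] therefore makes [D - 1] vanish at every pole of [f], and also
    at the conjugates of these poles, since they are on the unit circle and
    [l + 1/l] is the same there.  By unitarity the inverse of [f] is
    [l |-> (f l^* )^* ], whose poles are these conjugates.  All poles being
    simple, and no pole being the conjugate of another one,
    [M = f D f^-1 = 1 + f (D - 1) f^-1] stays bounded near every [c <> 0]
    ([conjugated_monodromy_bounded]).

    If [f E = E' f'] at [(x,t)], then at the shifted point
    [f D E = M f E = (M E') f'], while the dressing there gives another
    factorization of the same left-hand side.  Factorizations are unique
    ([loop_eq_of_bounded]): the quotient of two rational factors is a rational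
    map bounded near every [c <> 0] and, being unitary on the real axis, also
    along the reals near [0]; hence it has no poles, and it tends
    to [1] at infinity.  Hence the shift multiplies [E'] on the left by [M]
    ([factorization_shift]).  As [M] does not depend on [x], the logarithmic
    derivative [E'^-1 E'_x = a l + u] is unchanged by the shift, and [u] is
    periodic ([soliton_shift_and_skew]).

    Differentiating [E'^* E' = 1] at [l = 1] shows that [u] is skew-Hermitian.
    For two frames [G], [H] of the same skew-Hermitian [u] the product [G H^*]
    is constant in [x] and tends to [1], so a frame is determined by [u] and
    inherits its period ([frame_unique]).

    For the one-soliton, the only pole of [g_{z,p}] is the simple pole
    [z^* = exp (- i theta)], absent when [p = 1]; the cosine is that of
    [theta]. *)

(** * Polynomials and limits in a field with absolute value *)

Section NumField.
Local Open Scope classical_set_scope.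
Variable K : numFieldType.
Implicit Types (p q r : {poly K}) (c l w : K).

Lemma dnbhs_neq c c0 : \forall l \near c^', l != c0.
Proof.
have [<-|cc0] := eqVneq c c0; first exact: (@nbhs_dnbhs_neq K c).
apply: (@nbhs_dnbhs K c).
have cc0_gt0 : 0 < `|c - c0| by rewrite normr_gt0 subr_eq0.
apply: filterS (@nbhsx_ballx K K c _ cc0_gt0) => l /= cl; apply/eqP => lc0.
by move: cl; rewrite lc0 -ball_normE /= ltxx.
Qed.

Lemma dnbhs_notin c (s : seq K) : \forall l \near c^', l \notin s.
Proof.
elim: s => [|x s IH]; first exact: filterE.
apply: filterS2 (dnbhs_neq c x) IH => l lx ls.
by rewrite inE negb_or lx.
Qed.

(** Along the real axis, where loops are unitary, one can approach the
    essential singularity [0] of [exp (a t / l)]. *)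
Lemma dnbhs_real_proper :
  ProperFilter (within [set l : K | l \is Num.real] (0 : K)^').
Proof.
apply: Build_ProperFilter_ex => P.
rewrite /within /= => /nbhs_ballP[e /= e0 eP]; exists (e / 2).
have e2 : 0 < e / 2 by rewrite divr_gt0.
apply: eP; last 2 first.
- by rewrite gt_eqF.
- by rewrite realE (ltW e2).
rewrite -ball_normE /= sub0r normrN gtr0_norm //.
by rewrite ltr_pdivrMr // ltr_pMr // ltr1n.
Qed.

Lemma cvg_distP (T : Type) (F : set_system T) (f : T -> K) c : Filter F ->
  f x @[x --> F] --> c <-> (forall e, 0 < e -> \forall x \near F, `|c - f x| < e).
Proof. by move=> FF; split => [/cvgrPdist_lt|h]; [ | apply/cvgrPdist_lt]. Qed.

Lemma cvg_sum (T I : Type) (F : set_system T) (s : seq I) (f : I -> T -> K)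
    (a : I -> K) : Filter F -> (forall i, f i x @[x --> F] --> a i) ->
  \sum_(i <- s) f i x @[x --> F] --> \sum_(i <- s) a i.
Proof. by move=> FF fa; apply: cvg_big => //; exact: add_continuous. Qed.

Lemma cvg_horner (T : Type) (F : set_system T) (f : T -> K) p c :
  Filter F -> f y @[y --> F] --> c -> p.[f y] @[y --> F] --> p.[c].
Proof.
move=> FF fc; elim/poly_ind: p => [|p b IH].
  by under eq_fun do rewrite horner0; rewrite horner0; exact: cvg_cst.
under eq_fun do rewrite hornerMXaddC; rewrite hornerMXaddC.
by apply: cvgD; [apply: cvgM | exact: cvg_cst].
Qed.

(** [p] tends to [p.[c]] along [F], and to [0] because [M * q] does. *)
Lemma root_of_dominated (M : K) p q c (F : set_system K) :
  ProperFilter F -> F --> c ->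
  (\forall l \near F, `|p.[l]| <= M * `|q.[l]|) -> q.[c] = 0 -> p.[c] = 0.
Proof.
move=> FF Fc dom qc.
have pc : p.[l] @[l --> F] --> p.[c] by apply: cvg_horner.
have Mq0 : M * q.[l] @[l --> F] --> (0 : K).
  by rewrite -(mulr0 M) -qc; apply: cvgM; [exact: cvg_cst | exact: cvg_horner].
apply: (cvg_unique (@norm_hausdorff _ K^o) pc).
apply/cvgrPdist_lt => e e0; near=> l.
have le : `|p.[l]| <= M * `|q.[l]| by near: l.
rewrite sub0r normrN; apply: (@le_lt_trans _ _ `|M * q.[l]|).
  rewrite normrM -[`|q.[l]|]normr_id -normrM ger0_norm //.
  exact: le_trans le.
rewrite -normrN -sub0r; near: l; exact: cvgr_dist_lt.
Unshelve. all: by end_near. Qed.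

(** Writing [r = r1 * 'X + c], the value [r1.[w^-1] = w * (r.[w^-1] - c)]
    tends to [0], so [r1 = 0] by induction on the degree. *)
Lemma const_of_cvg_infty r (L : K) (F : set_system K) :
  ProperFilter F -> F --> (0 : K)^' -> r.[w^-1] @[w --> F] --> L -> r = L%:P.
Proof.
move=> FF F0; elim/poly_ind: r L => [|r c IH] L h.
  rewrite (_ : L = 0) ?polyC0 //; apply: (cvg_unique (@norm_hausdorff _ K^o) h) => /=.
  by under eq_fun do rewrite horner0; exact: cvg_cst.
suff r0 : r = 0.
  move: h; rewrite r0 mul0r add0r => h; congr (_%:P).
  apply: (cvg_unique (@norm_hausdorff _ K^o)) h => /=.
  by under eq_fun do rewrite hornerC; exact: cvg_cst.
rewrite (IH 0) ?polyC0 //.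
have w0 : w @[w --> F] --> (0 : K).
  by apply: cvg_trans F0 _; exact: nbhs_dnbhs.
have : w * ((r * 'X + c%:P).[w^-1] - c) @[w --> F] --> 0 * (L - c).
  by apply: cvgM => //; apply: cvgB => //; exact: cvg_cst.
rewrite mul0r; apply: cvg_trans; apply: near_eq_cvg.
have w_neq0 : \forall w \near F, w != 0 by exact: (F0 _ (@nbhs_dnbhs_neq K 0)).
near=> w; rewrite hornerMXaddC addrK mulrCA mulfV ?mulr1 //.
by near: w.
Unshelve. all: by end_near. Qed.

End NumField.

Section Complex.
Local Open Scope classical_set_scope.
Variable K : numClosedFieldType.
Implicit Types (p q r : {poly K}) (c l w : K).

Lemma conj_horner p l : (map_poly Num.conj p).[l] = (p.[l^*])^*.
Proof. by rewrite -{1}[l]conjCK horner_map. Qed.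

Lemma root_conj_poly p l : root (map_poly Num.conj p) l = root p l^*.
Proof. by rewrite !rootE conj_horner conjC_eq0. Qed.

Lemma poly_eq_off_roots e p q : e != 0 ->
  (forall l, ~~ root e l -> p.[l] = q.[l]) -> p = q.
Proof.
move=> e0 pq; apply/eqP; rewrite -subr_eq0.
suff : (p - q) * e == 0 by rewrite mulf_eq0 (negPf e0) orbF.
apply/negPn/negP => /closed_nonrootP[l]; rewrite rootM negb_or => /andP[+ el].
by rewrite rootE hornerD hornerN pq // subrr eqxx.
Qed.

Lemma near_nonroot e c : e != 0 ->
  \forall l \near (c : (K : numFieldType))^', ~~ root e l.
Proof.
move=> e0; have [s eE] := closed_field_poly_normal e.
apply: filterS (dnbhs_notin c s) => l ls.
by rewrite eE rootZ ?lead_coef_eq0 // root_prod_XsubC.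
Qed.

Lemma near_nonroot_inv e : e != 0 ->
  \forall w \near (0 : (K : numFieldType))^', ~~ root e w^-1.
Proof.
move=> e0; have [s eE] := closed_field_poly_normal e.
apply: filterS (dnbhs_notin (0 : (K : numFieldType)) (map GRing.inv s)) => w ws.
rewrite eE rootZ ?lead_coef_eq0 // root_prod_XsubC.
by apply: contra ws => ws; apply/mapP; exists w^-1; rewrite ?invrK.
Qed.

Lemma cvg_conj_dnbhs c :
  (Num.conj : K -> K) @ (c : (K : numFieldType))^' -->
  (c^* : (K : numFieldType))^'.
Proof.
move=> P /nbhs_ballP[e /= e0 eP]; apply/nbhs_ballP; exists e => // w we wc.
apply: eP; last by rewrite (inj_eq (can_inj conjCK)).
by move: we; rewrite -!ball_normE /= -rmorphB norm_conjC.
Qed.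

Lemma cvg_conj (T : Type) (F : set_system T) (f : T -> K) (c : K) :
  Filter F -> f x @[x --> F] --> c -> (f x)^* @[x --> F] --> c^*.
Proof.
move=> FF fc; apply/cvgrPdist_lt => e e0; near=> y.
by rewrite -rmorphB norm_conjC; near: y; exact: cvgr_dist_lt.
Unshelve. all: by end_near. Qed.

(** A rational function without poles is a polynomial.  Each root of [q] is a
    root of [p]; the common linear factor cancels from the bound away from that
    root, and the degree of [q] drops.  The filter [F] leaves free the direction
    in which [c] is approached. *)
Lemma dvdp_of_dominated p q : q != 0 ->
  (forall c, exists M (F : set_system (K : numFieldType)),
     [/\ ProperFilter F, F --> c^' & \forall l \near F, `|p.[l]| <= M * `|q.[l]|]) ->
  q %| p.
Proof.
move: {2}(size q) (leqnn (size q)) => m.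
elim: m p q => [|m IH] p q.
  by rewrite leqn0 size_poly_eq0 => ->.
move=> sq q0 dom; have [sq1|sq1] := boolP (size q == 1%N).
  by rewrite (eqp_dvdl _ (_ : q %= 1)) ?dvd1p // -size_poly_eq1.
have /closed_rootP[c0 qc0] := sq1.
have [M [F [FF Fc Fdom]]] := dom c0.
have pc0 : root p c0.
  apply/rootP; apply: (@root_of_dominated _ M p q c0 F) => //.
    by apply: cvg_trans Fc _; exact: nbhs_dnbhs.
  exact/rootP.
have [q1 q1E] := factor_theorem _ _ qc0.
have [p1 p1E] := factor_theorem _ _ pc0.
have q10 : q1 != 0 by apply: contraNneq q0 => z; rewrite q1E z mul0r.
rewrite q1E p1E dvdp_mul2r ?polyXsubC_eq0 //; apply: IH => //.
  by move: sq; rewrite q1E size_Mmonic ?monicXsubC // size_XsubC addn2.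
move=> c; have [M1 [F1 [FF1 F1c F1dom]]] := dom c; exists M1, F1; split=> //.
have : \forall l \near F1, (l : (K : numFieldType)) != c0.
  exact: (F1c _ (dnbhs_neq c c0)).
apply: filterS2 F1dom => l /=; rewrite p1E q1E !hornerM !normrM mulrA => + lc0.
by rewrite ler_pM2r // hornerXsubC normr_gt0 subr_eq0.
Qed.

End Complex.
(** * Functions bounded along a filter *)

Section EventuallyBounded.
Local Open Scope classical_set_scope.
Variables (K : numFieldType) (T : Type) (F : set_system T).
Context {FF : Filter F}.
Implicit Types f g : T -> K.

Definition eventually_bounded f := exists M : K, \forall x \near F, `|f x| <= M.

Lemma eventually_bounded_cvg f (c : K) : f x @[x --> F] --> c -> eventually_bounded f.
Proof.
move=> fc; exists (`|c| + 1); near=> x.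
rewrite -[f x](subrK c) (le_trans (ler_normD _ _)) // addrC lerD2l.
rewrite distrC ltW //; near: x; exact: cvgr_dist_lt.
Unshelve. all: by end_near. Qed.

Lemma eventually_boundedM f g : eventually_bounded f -> eventually_bounded g ->
  eventually_bounded (fun x => f x * g x).
Proof.
move=> [M fM] [M' gM]; exists (M * M').
by apply: filterS2 fM gM => x fx gx; rewrite normrM ler_pM.
Qed.

Lemma eventually_bounded_sum (I : Type) (s : seq I) (f : I -> T -> K) :
  (forall i, eventually_bounded (f i)) ->
  eventually_bounded (fun x => \sum_(i <- s) f i x).
Proof.
move=> fb; elim: s => [|i s [M sM]].
  by exists 0; apply: filterE => x; rewrite big_nil normr0.
have [M' iM] := fb i; exists (M' + M).
apply: filterS2 iM sM => x ix sx; rewrite big_cons.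
by rewrite (le_trans (ler_normD _ _)) // lerD.
Qed.

Lemma eventually_bounded_near f g : (\forall x \near F, f x = g x) ->
  eventually_bounded f -> eventually_bounded g.
Proof.
by move=> fg [M fM]; exists M; apply: filterS2 fg fM => x ->.
Qed.

End EventuallyBounded.

(** * Rational loops *)

Section Loops.
Local Open Scope classical_set_scope.
Local Open Scope sesquilinear_scope.
Variables (R : realType) (n : nat).
Local Notation C := R[i].
Implicit Types (f : C -> 'M[C]_n) (N : 'M[{poly C}]_n) (d e : {poly C}) (l c : C).

Definition adjoint_loop f l : 'M[C]_n := (f l^*) ^t*.

Lemma reduced_fraction_neq0 f N d : reduced_fraction f N d -> d != 0.
Proof. by case=> /monic_neq0. Qed.

(** Cross-multiplying gives [N1 * d2 = N2 * d1]; at a root [p] of [d1] some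
    entry of [N1] does not vanish, so all the multiplicity of [p] in the right
    side is carried by [d2]. *)
Lemma reduced_fraction_mup_le f N1 d1 N2 d2 p :
  reduced_fraction f N1 d1 -> reduced_fraction f N2 d2 ->
  (mup p d1 <= mup p d2)%N.
Proof.
move=> r1 r2; have d10 := reduced_fraction_neq0 r1.
have d20 := reduced_fraction_neq0 r2.
have [|/mupNroot -> //] := boolP (root d1 p).
case: r1 => _ low1 f1 /low1[i [j Nij]]; case: r2 => _ _ f2.
have NE : N1 i j * d2 = N2 i j * d1.
  apply: (@poly_eq_off_roots _ (d1 * d2)); first by rewrite mulf_neq0.
  move=> l; rewrite rootM negb_or => /andP[h1 h2].
  have /matrixP/(_ i j) := f2 l h2; rewrite (f1 l h1) !mxE !hornerM => E.
  move: h1 h2; rewrite !rootE => h1 h2.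
  by rewrite (canRL (mulVKf h1) E); field.
have N0 : N1 i j != 0 by apply: contraNneq Nij => ->; rewrite horner0.
have -> : mup p d2 = mup p (N1 i j * d2) by rewrite mupMr // rootE.
have N20 : N2 i j != 0.
  by apply: contraNneq (mulf_neq0 N0 d20) => z; rewrite NE z mul0r.
by rewrite NE mupM // leq_addl.
Qed.

Lemma reduced_fraction_mup f N1 d1 N2 d2 p :
  reduced_fraction f N1 d1 -> reduced_fraction f N2 d2 -> mup p d1 = mup p d2.
Proof.
move=> r1 r2; apply/eqP.
by rewrite eqn_leq !(reduced_fraction_mup_le p r1 r2, reduced_fraction_mup_le p r2 r1).
Qed.

Lemma root_mup d l : d != 0 -> root d l = (0 < mup l d)%N.
Proof. by move=> d0; rewrite -XsubC_dvd // dvdp_XsubCl. Qed.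

Lemma is_pole_root f N d l : reduced_fraction f N d -> is_pole f l <-> root d l.
Proof.
move=> r; rewrite root_mup ?(reduced_fraction_neq0 r) //; split.
  by move=> [m [N' [d' [r' h]]]]; rewrite (reduced_fraction_mup l r r') h.
by move=> h; exists (mup l d).-1, N, d; split=> //; rewrite prednK.
Qed.

Lemma adjmxM (A B : 'M[C]_n) : (A *m B) ^t* = B ^t* *m A ^t*.
Proof. by rewrite trmx_mul map_mxM. Qed.

Lemma entry_le1_of_unitary (U : 'M[C]_n) i j : U ^t* *m U = 1%:M -> `|U i j| <= 1.
Proof.
move=> /matrixP/(_ j j); rewrite !mxE eqxx mulr1n => h.
rewrite -[leLHS]ger0_norm ?normr_ge0 // -(@ler_pXn2r _ 2) ?nnegrE ?ler01 //.
rewrite expr1n -h (bigD1 i) //= !mxE normr_id -normCKC lerDl.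
by apply: sumr_ge0 => k _; rewrite !mxE -normCKC exprn_ge0.
Qed.

(** Liouville for the quotient [f2 * f1^-1], where [f1^-1] is the adjoint loop
    of [f1].  It is bounded near each [c <> 0] by hypothesis and near [0] along
    the reals, where it is a unitary matrix; so its entries are polynomials,
    and their limits at infinity make it [1]. *)
Lemma loop_eq_of_bounded f1 f2 : rational_loop f1 -> rational_loop f2 ->
  (forall c, c != 0 -> forall i j, exists M : C,
     \forall l \near (c : C^o)^', `|(f2 l *m adjoint_loop f1 l) i j| <= M) ->
  exists2 e : {poly C}, e != 0 &
    forall l, ~~ root e l ->
      [/\ f2 l = f1 l, ~ is_pole f1 l, ~ is_pole f2 l & f1 l \in unitmx].
Proof.
move=> [[N1 [d1 r1]] _ inf1 unit1] [[N2 [d2 r2]] _ inf2 unit2] bnd.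
have cd1 := fun l => is_pole_root l r1; have cd2 := fun l => is_pole_root l r2.
pose cj := map_poly (Num.conj : C -> C).
pose e := (d1 * cj d1) * (d2 * cj d2).
have cj0 d : d != 0 -> cj d != 0 by move=> d0; rewrite map_poly_eq0.
have d10 := reduced_fraction_neq0 r1; have d20 := reduced_fraction_neq0 r2.
have e0 : e != 0 by rewrite !mulf_neq0 ?cj0.
have eP l : ~~ root e l ->
    [/\ ~~ root d1 l, ~~ root d1 l^*, ~~ root d2 l & ~~ root d2 l^*].
  rewrite !rootM !negb_or !(@root_conj_poly _ _ l).
  by move=> /andP[/andP[-> ->] /andP[-> ->]].
have un1 l : ~~ root e l -> f1 l *m adjoint_loop f1 l = 1%:M.
  move=> /eP[/negP h1 /negP h2 _ _]; apply: mulmx1C.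
  by apply: unit1; rewrite cd1.
have un2 l : ~~ root e l -> adjoint_loop f2 l *m f2 l = 1%:M.
  by move=> /eP[_ _ /negP h1 /negP h2]; apply: unit2; rewrite cd2.
pose P i j := \sum_k N2 i k * cj (N1 j k).
pose q := d2 * cj d1.
have q0 : q != 0 by rewrite mulf_neq0 ?cj0.
have hE l i j : ~~ root e l ->
    (f2 l *m adjoint_loop f1 l) i j = (P i j).[l] / q.[l].
  move=> /eP[h1 h1' h2 _]; case: r1 => _ _ f1E; case: r2 => _ _ f2E.
  rewrite /adjoint_loop (f1E _ h1') (f2E _ h2) !mxE horner_sum mulr_suml.
  apply: eq_bigr => k _; rewrite !mxE rmorphM /= fmorphV !hornerM.
  by rewrite !conj_horner invfM; ring.
have qP l : ~~ root e l -> q.[l] != 0.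
  by move=> /eP[_ h1 h2 _]; rewrite -rootE rootM negb_or h2 /q root_conj_poly.
have PE i j : P i j = ((i == j)%:R)%:P * q.
  have /dvdpP[r rE] : q %| P i j.
    apply: dvdp_of_dominated => // c; have [->|c0] := eqVneq c 0.
      (* On the real axis the quotient is unitary, so its entries are at most 1. *)
      exists 1, (within [set l : C^o | l \is Num.real] (0 : C^o)^').
      split; [exact: dnbhs_real_proper | exact: cvg_within |].
      apply: filterS (near_nonroot (0 : C) e0) => l el lr.
      rewrite mul1r -[leRHS]mul1r -ler_pdivrMr ?normr_gt0 ?qP // -normf_div -hE //.
      have lE : l^* = l := CrealP lr.
      have := un1 l el; have := un2 l el; rewrite /adjoint_loop lE => U2 U1.
      by apply: entry_le1_of_unitary; rewrite adjmxM trmxCK mulmxA -(mulmxA (f1 l)) U2 mulmx1.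
    have [M hM] := bnd c c0 i j.
    exists M, (c : C^o)^'; split; [exact: Proper_dnbhs_numFieldType | exact: cvg_id |].
    apply: filterS2 (near_nonroot c e0) hM => l el.
    by rewrite hE // normrM normfV ler_pdivrMr // normr_gt0 qP.
  rewrite rE; congr (_ * _).
  apply: (@const_of_cvg_infty _ r _ (0 : C^o)^').
    exact: cvg_id.
  have -> : (i == j)%:R = \sum_k (1%:M : 'M[C]_n) i k * ((1%:M : 'M[C]_n) j k)^* :> C^o.
    rewrite (bigD1 j) //= big1 => [|k kj]; rewrite !mxE ?eqxx ?conjC1 ?mulr1 ?addr0 //.
    by rewrite [j == k]eq_sym (negPf kj) conjC0 mulr0.
  have lim : (\sum_k f2 w^-1 i k * (f1 (w^*)^-1 j k)^* : C^o) @[w --> (0 : C^o)^'] -->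
      (\sum_k (1%:M : 'M[C]_n) i k * ((1%:M : 'M[C]_n) j k)^* : C^o).
    apply: cvg_sum => k; apply: cvgM; first exact: inf2.
    apply: cvg_conj.
    have cj0' : (Num.conj : C -> C) @ (0 : C^o)^' --> (0 : C^o)^'.
      by have := @cvg_conj_dnbhs C 0; rewrite conjC0.
    exact: (cvg_comp _ _ cj0' (inf1 j k)).
  apply: cvg_trans lim; apply: near_eq_cvg.
  apply: filterS (near_nonroot_inv e0) => w ew.
  have := hE w^-1 i j ew; rewrite rE hornerM mulfK ?qP // => <-.
  by rewrite mxE; apply: eq_bigr => k _; rewrite !mxE fmorphV.
exists e => // l el; have [h1 h1' h2 h2'] := eP l el; split.
- have h1E : f2 l *m adjoint_loop f1 l = 1%:M.
    by apply/matrixP => i j; rewrite hE // PE hornerM hornerC mulfK ?qP // mxE.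
  by rewrite -[LHS]mulmx1 -(mulmx1C (un1 l el)) mulmxA h1E mul1mx.
- by rewrite cd1; apply/negP.
- by rewrite cd2; apply/negP.
- by have /mulmx1_unit[] := un1 l el.
Qed.

End Loops.
(** * Derivatives and the complex exponential *)

Section ComplexDerivative.
Variable R : realType.
Local Notation C := R[i].
Implicit Types (f g : R -> C) (c d : C) (x y h s : R).

Definition is_derive_complex f x d :=
  is_derive x 1 (fun s => complex.Re (f s)) (complex.Re d) /\
  is_derive x 1 (fun s => complex.Im (f s)) (complex.Im d).

Lemma complexReD c d : complex.Re (c + d) = complex.Re c + complex.Re d.
Proof. by case: c => a b; case: d. Qed.

Lemma complexImD c d : complex.Im (c + d) = complex.Im c + complex.Im d.
Proof. by case: c => a b; case: d. Qed.

Lemma complexReN c : complex.Re (- c) = - complex.Re c.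
Proof. by case: c. Qed.

Lemma complexImN c : complex.Im (- c) = - complex.Im c.
Proof. by case: c. Qed.

Lemma complexReJ c : complex.Re c^* = complex.Re c.
Proof. by case: c. Qed.

Lemma complexImJ c : complex.Im c^* = - complex.Im c.
Proof. by case: c. Qed.

Lemma complexReM c d : complex.Re (c * d) =
  complex.Re c * complex.Re d - complex.Im c * complex.Im d.
Proof. by case: c => a b; case: d. Qed.

Lemma complexImM c d : complex.Im (c * d) =
  complex.Re c * complex.Im d + complex.Im c * complex.Re d.
Proof. by case: c => a b; case: d => a' b' /=; rewrite addrC. Qed.

Lemma complex_eq c d :
  complex.Re c = complex.Re d -> complex.Im c = complex.Im d -> c = d.
Proof. by case: c => a b; case: d => a' b' /= -> ->. Qed.

Lemma is_derive_complex_cst c x : is_derive_complex (fun=> c) x 0.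
Proof. by split; exact: is_derive_cst. Qed.

Lemma is_derive_complexD f g x c d :
  is_derive_complex f x c -> is_derive_complex g x d ->
  is_derive_complex (fun s => f s + g s) x (c + d).
Proof.
move=> [f1 f2] [g1 g2]; split.
  rewrite complexReD (_ : (fun s => _) = (fun s => complex.Re (f s)) + (fun s => complex.Re (g s))).
    exact: is_deriveD.
  by apply/funext => s; rewrite complexReD.
rewrite complexImD (_ : (fun s => _) = (fun s => complex.Im (f s)) + (fun s => complex.Im (g s))).
  exact: is_deriveD.
by apply/funext => s; rewrite complexImD.
Qed.

Lemma is_derive_complexM f g x c d :
  is_derive_complex f x c -> is_derive_complex g x d ->
  is_derive_complex (fun s => f s * g s) x (c * g x + f x * d).
Proof.
move=> [f1 f2] [g1 g2]; split.
  rewrite (_ : (fun s => _) = (fun s => complex.Re (f s)) * (fun s => complex.Re (g s))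
     - (fun s => complex.Im (f s)) * (fun s => complex.Im (g s))); last first.
    by apply/funext => s; rewrite complexReM.
  apply: is_derive_eq; rewrite complexReD !complexReM /GRing.scale /=; ring.
rewrite (_ : (fun s => _) = (fun s => complex.Re (f s)) * (fun s => complex.Im (g s))
   + (fun s => complex.Im (f s)) * (fun s => complex.Re (g s))); last first.
  by apply/funext => s; rewrite complexImM.
apply: is_derive_eq; rewrite complexImD !complexImM /GRing.scale /=; ring.
Qed.

Lemma is_derive_complex_sum n (F : 'I_n -> R -> C) (D : 'I_n -> C) x :
  (forall k, is_derive_complex (F k) x (D k)) ->
  is_derive_complex (fun s => \sum_k F k s) x (\sum_k D k).
Proof.
elim: n F D => [|n IH] F D FD.
  under eq_fun do rewrite big_ord0; rewrite big_ord0; exact: is_derive_complex_cst.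
under eq_fun do rewrite big_ord_recl; rewrite big_ord_recl.
by apply: is_derive_complexD => //; apply: IH.
Qed.

Lemma is_derive_complex_conj f x d :
  is_derive_complex f x d -> is_derive_complex (fun s => (f s)^*) x d^*.
Proof.
move=> [f1 f2]; split; [rewrite complexReJ | rewrite complexImJ].
  by under eq_fun do rewrite complexReJ.
rewrite (_ : (fun s => _) = - (fun s => complex.Im (f s))); first exact: is_deriveN.
by apply/funext => s; rewrite complexImJ.
Qed.

Lemma is_derive_complex_unique f x c d :
  is_derive_complex f x c -> is_derive_complex f x d -> c = d.
Proof.
move=> [f1 f2] [g1 g2]; apply: complex_eq.
  by rewrite -(@derive_val _ _ _ _ _ _ _ f1) -(@derive_val _ _ _ _ _ _ _ g1).
by rewrite -(@derive_val _ _ _ _ _ _ _ f2) -(@derive_val _ _ _ _ _ _ _ g2).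
Qed.

Lemma is_derive_complex_shift f x h d :
  is_derive_complex f (x + h) d -> is_derive_complex (fun s => f (s + h)) x d.
Proof.
have hs : is_derive x 1 (fun s : R => s + h) 1.
  rewrite (_ : (fun s => _) = id + cst h) //; apply: is_derive_eq; exact: addr0.
move=> [f1 f2]; split.
  have := @is_derive1_comp R (fun s => complex.Re (f s)) (fun s => s + h) x _ _ f1 hs.
  by rewrite mulr1.
have := @is_derive1_comp R (fun s => complex.Im (f s)) (fun s => s + h) x _ _ f2 hs.
by rewrite mulr1.
Qed.

Lemma is_derive_complex0_cst f x y :
  (forall s, is_derive_complex f s 0) -> f x = f y.
Proof.
move=> f0; apply: complex_eq.
  by apply: (@is_derive_0_is_cst _ (fun s => complex.Re (f s))) => s; case: (f0 s).
by apply: (@is_derive_0_is_cst _ (fun s => complex.Im (f s))) => s; case: (f0 s).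
Qed.

Definition cexp c : C :=
  ((expR (complex.Re c) * cos (complex.Im c)) +i* (expR (complex.Re c) * sin (complex.Im c)))%C.

Lemma cexpD c d : cexp (c + d) = cexp c * cexp d.
Proof.
case: c d => [a b] [a' b']; apply: complex_eq; rewrite ?(complexReM,complexImM) /=.
  by rewrite expRD cosD; ring.
by rewrite expRD sinD; ring.
Qed.

Lemma cexp0 : cexp 0 = 1.
Proof. by rewrite /cexp /= expR0 cos0 sin0 mulr1 mulr0. Qed.

Lemma cexpN c : cexp (- c) * cexp c = 1.
Proof. by rewrite -cexpD addNr cexp0. Qed.

Lemma is_derive_cexp c x :
  is_derive_complex (fun s => cexp (c * s%:C%C)) x (c * cexp (c * x%:C%C)).
Proof.
have hl a : is_derive x 1 (fun s : R => a * s) a.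
  rewrite (_ : (fun s => _) = a *: id) //; apply: is_derive_eq.
  by rewrite /GRing.scale /= mulr1.
have he : is_derive x 1 (fun s => expR (complex.Re c * s)) (expR (complex.Re c * x) * complex.Re c).
  exact: (@is_derive1_comp _ _ _ _ _ _ (is_derive_expR _) (hl _)).
have hc : is_derive x 1 (fun s => cos (complex.Im c * s)) (- sin (complex.Im c * x) * complex.Im c).
  exact: (@is_derive1_comp _ _ _ _ _ _ (is_derive_cos _) (hl _)).
have hs : is_derive x 1 (fun s => sin (complex.Im c * s)) (cos (complex.Im c * x) * complex.Im c).
  exact: (@is_derive1_comp _ _ _ _ _ _ (is_derive_sin _) (hl _)).
have cE s : (complex.Re (c * s%:C%C) = complex.Re c * s) * (complex.Im (c * s%:C%C) = complex.Im c * s).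
  by rewrite complexReM complexImM /= !mulr0 subr0 add0r.
split.
  rewrite (_ : (fun s => _) = (fun s => expR (complex.Re c * s)) * (fun s => cos (complex.Im c * s))).
    by apply: is_derive_eq; rewrite complexReM /= !cE /GRing.scale /=; ring.
  by apply/funext => s; rewrite /= !cE.
rewrite (_ : (fun s => _) = (fun s => expR (complex.Re c * s)) * (fun s => sin (complex.Im c * s))).
  by apply: is_derive_eq; rewrite complexImM /= !cE /GRing.scale /=; ring.
by apply/funext => s; rewrite /= !cE.
Qed.

(** [f s * cexp (- c * s)] has zero derivative. *)
Lemma linear_ode f c x h :
  (forall s, is_derive_complex f s (f s * c)) -> f (x + h) = f x * cexp (c * h%:C%C).
Proof.
move=> fc.
have : f (x + h) * cexp (- c * (x + h)%:C%C) = f x * cexp (- c * x%:C%C).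
  apply: (@is_derive_complex0_cst (fun s => f s * cexp (- c * s%:C%C))) => s.
  have := is_derive_complexM (fc s) (is_derive_cexp (- c) s).
  by rewrite (_ : _ + _ = 0) //; ring.
move=> /(congr1 (fun w => w * cexp (c * (x + h)%:C%C))).
rewrite -mulrA mulNr cexpN mulr1 => ->; rewrite -mulrA -cexpD; congr (_ * cexp _).
by rewrite rmorphD /=; ring.
Qed.

Lemma cexp_2pi (m : int) : cexp ((2 * pi * m%:~R)%:C%C * 'i) = 1.
Proof.
have nat_case (k : nat) : cexp ((2 * pi * k%:R)%:C%C * 'i) = 1.
  rewrite -complexiE /cexp complexReM complexImM /= !mulr0 !mul0r mulr1 subr0 addr0 expR0 !mul1r.
  rewrite mulr_natr mulr_natl.
  have h1 : cos (pi *+ 2 *+ k : R) = 1.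
    elim: k => [|k IH]; first by rewrite cos0.
    by rewrite mulrSr cosD2pi.
  have h2 : sin (pi *+ 2 *+ k : R) = 0.
    elim: k {h1} => [|k IH]; first by rewrite sin0.
    by rewrite mulrSr sinD2pi.
  by rewrite h1 h2.
case: m => k; first exact: nat_case.
have := cexpN ((2 * pi * k.+1%:R)%:C%C * 'i); rewrite nat_case mulr1 => <-.
by congr cexp; rewrite NegzE mulrNz mulrN rmorphN mulNr.
Qed.

End ComplexDerivative.
(** * Arithmetic of limits *)

Section LimitArithmetic.
Local Open Scope classical_set_scope.
Variables (K : numFieldType) (T : Type) (F : set_system T).
Context {FF : Filter F}.
Implicit Types (f g : T -> K) (b c : K).

Lemma cvg_add f g b c : f x @[x --> F] --> b -> g x @[x --> F] --> c ->
  f x + g x @[x --> F] --> b + c.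
Proof. exact: cvgD. Qed.

Lemma cvg_sub f g b c : f x @[x --> F] --> b -> g x @[x --> F] --> c ->
  f x - g x @[x --> F] --> b - c.
Proof. exact: cvgB. Qed.

Lemma cvg_mul f g b c : f x @[x --> F] --> b -> g x @[x --> F] --> c ->
  f x * g x @[x --> F] --> b * c.
Proof. exact: cvgM. Qed.

Lemma cvg_inv f b : b != 0 -> f x @[x --> F] --> b -> (f x)^-1 @[x --> F] --> b^-1.
Proof. exact: cvgV. Qed.

Lemma cvg_const b : (fun=> b) @ F --> b.
Proof. exact: cvg_cst. Qed.

End LimitArithmetic.

(** The same rules on [R[i]], whose topology is carried by the alias
    [R[i]^o]. *)
Section ComplexLimits.
Local Open Scope classical_set_scope.
Variables (R : realType) (T : Type) (F : set_system T).
Context {FF : Filter F}.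
Local Notation C := R[i].
Implicit Types (f g : T -> C) (b c : C).

Lemma complex_cvgD f g b c : (f x : C^o) @[x --> F] --> (b : C^o) ->
  (g x : C^o) @[x --> F] --> (c : C^o) ->
  (f x + g x : C^o) @[x --> F] --> (b + c : C^o).
Proof. exact: (@cvg_add C _ _ _ f g b c). Qed.

Lemma complex_cvgB f g b c : (f x : C^o) @[x --> F] --> (b : C^o) ->
  (g x : C^o) @[x --> F] --> (c : C^o) ->
  (f x - g x : C^o) @[x --> F] --> (b - c : C^o).
Proof. exact: (@cvg_sub C _ _ _ f g b c). Qed.

Lemma complex_cvgM f g b c : (f x : C^o) @[x --> F] --> (b : C^o) ->
  (g x : C^o) @[x --> F] --> (c : C^o) ->
  (f x * g x : C^o) @[x --> F] --> (b * c : C^o).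
Proof. exact: (@cvg_mul C _ _ _ f g b c). Qed.

Lemma complex_cvgV f b : b != 0 -> (f x : C^o) @[x --> F] --> (b : C^o) ->
  ((f x)^-1 : C^o) @[x --> F] --> (b^-1 : C^o).
Proof. exact: (@cvg_inv C _ _ _ f b). Qed.

Lemma complex_cvg_cst b : (b : C^o) @[_ --> F] --> (b : C^o).
Proof. exact: (@cvg_const C _ F _ b). Qed.

End ComplexLimits.

Section ComplexExponential.
Variable R : realType.
Local Notation C := R[i].
Implicit Types (c w : C).

Lemma norm_real (x : R) : `|x%:C%C : C| = `|x|%:C%C.
Proof. by rewrite normc_def /= expr0n addr0 sqrtr_sqr. Qed.

Lemma norm_le_Re_Im c : `|c| <= (`|complex.Re c| + `|complex.Im c|)%:C%C.
Proof.
rewrite {1}[c]complexE (le_trans (ler_normD _ _)) // rmorphD /=.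
by rewrite normrM complexiE normCi mul1r !norm_real.
Qed.

Lemma normc_ge_Im c : `|complex.Im c|%:C%C <= `|c|.
Proof.
have := normc_ge_Re ('i%C * c).
by rewrite normrM {2}complexiE normCi mul1r complexReM /= mul0r mul1r sub0r normrN.
Qed.

Lemma norm_cexp c : `|cexp c| = (expR (complex.Re c))%:C%C.
Proof.
rewrite normc_def /= !exprMn -mulrDr cos2Dsin2 mulr1 sqrtr_sqr ger0_norm //.
Qed.

(** Mean value theorem on [0, 1] for the real and imaginary parts of
    [s |-> cexp (w * s)], whose derivative has norm at most [expR 1 * `|w|];
    the factor [2] comes from adding the two parts. *)
Lemma cexp_sub1_le w : `|w| <= 1 -> `|cexp w - 1| <= (2 * expR 1)%:C%C * `|w|.
Proof.
move=> w1.
have bound (s : R) : s \in `]0, 1[ -> `|w * cexp (w * s%:C%C)| <= (expR 1)%:C%C * `|w|.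
  rewrite in_itv /= => /andP[s0 s1].
  rewrite normrM mulrC ler_wpM2r ?normr_ge0 // norm_cexp lecR ler_expR.
  rewrite complexReM /= mulr0 subr0 (le_trans (ler_norm _)) // normrM (gtr0_norm s0).
  have : `|complex.Re w| <= 1 by rewrite -lecR (le_trans (normc_ge_Re _)).
  by move=> rw; rewrite -[leRHS]mulr1 ler_pM // ltW.
have [c cI cE] : exists2 c : R, c \in `]0, 1[ &
    complex.Re (cexp w - 1) = complex.Re (w * cexp (w * c%:C%C)).
  have [x _||c cI E] := @MVT _ (fun s => complex.Re (cexp (w * s%:C%C)))
    (fun s => complex.Re (w * cexp (w * s%:C%C))) 0 1 ltr01.
  - by have [] := is_derive_cexp w x.
  - apply: derivable_within_continuous => x _.
    by have [[]] := is_derive_cexp w x.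
  exists c => //; move: E; rewrite subr0 mulr1 => <-.
  by rewrite mulr1 mulr0 cexp0 complexReD complexReN.
have [c' cI' cE'] : exists2 c : R, c \in `]0, 1[ &
    complex.Im (cexp w - 1) = complex.Im (w * cexp (w * c%:C%C)).
  have [x _||c' cI' E] := @MVT _ (fun s => complex.Im (cexp (w * s%:C%C)))
    (fun s => complex.Im (w * cexp (w * s%:C%C))) 0 1 ltr01.
  - by have [] := is_derive_cexp w x.
  - apply: derivable_within_continuous => x _.
    by have [_ []] := is_derive_cexp w x.
  exists c' => //; move: E; rewrite subr0 mulr1 => <-.
  by rewrite mulr1 mulr0 cexp0 complexImD complexImN.
rewrite (le_trans (norm_le_Re_Im _)) // cE cE' mulr_natl mulr2n !rmorphD /= mulrDl.
apply: lerD.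
  by rewrite (le_trans (normc_ge_Re _)) // bound.
by rewrite (le_trans (normc_ge_Im _)) // bound.
Qed.

Local Open Scope classical_set_scope.

Lemma cvg_cexp (T : Type) (F : set_system T) (f : T -> C) c : Filter F ->
  (f x : C^o) @[x --> F] --> (c : C^o) ->
  (cexp (f x) : C^o) @[x --> F] --> (cexp c : C^o).
Proof.
move=> FF fc.
have fcs (e : C) : 0 < e -> \forall x \near F, `|c - f x| < e.
  by move: e; exact/cvg_distP.
have f1 : (cexp (f x - c) : C^o) @[x --> F] --> (1 : C^o).
  apply/cvg_distP => e e0.
  have k0 : 0 < (2 * expR 1)%:C%C :> C by rewrite ltcR mulr_gt0 ?expR_gt0.
  near=> x.
  have x1 : `|f x - c| <= 1.
    by rewrite ltW // distrC; near: x; exact: fcs.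
  rewrite distrC (le_lt_trans (cexp_sub1_le x1)) // mulrC -ltr_pdivlMr // distrC.
  by near: x; apply: fcs; rewrite divr_gt0.
rewrite -[cexp c]mulr1.
rewrite (_ : (fun x => _) = (fun x => cexp c * cexp (f x - c))); last first.
  by apply/funext => x; rewrite -cexpD addrC subrK.
have cc := @complex_cvg_cst R T F FF (cexp c).
exact: (complex_cvgM cc f1).
Unshelve. all: by end_near. Qed.

End ComplexExponential.

(** * Frames *)

Section Frames.
Local Open Scope classical_set_scope.
Local Open Scope sesquilinear_scope.
Variables (R : realType) (n : nat).
Local Notation C := R[i].
Implicit Types (G H : R -> 'M[C]_n) (A B : 'M[C]_n) (x h : R).

Lemma is_derive_mxM G H x A B : is_derive_mx G x A -> is_derive_mx H x B ->
  is_derive_mx (fun s => G s *m H s) x (A *m H x + G x *m B).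
Proof.
move=> GA HB i j; rewrite !mxE -big_split /=.
under eq_fun do rewrite mxE; under [X in _ /\ is_derive _ _ X _]eq_fun do rewrite mxE.
apply: (@is_derive_complex_sum _ _ (fun k s => G s i k * H s k j)) => k.
by apply: (@is_derive_complexM _ (fun s => G s i k)); [exact: GA | exact: HB].
Qed.

Lemma is_derive_mx_cst A x : is_derive_mx (fun=> A) x 0.
Proof. by move=> i j; rewrite mxE; exact: is_derive_complex_cst. Qed.

Lemma is_derive_mx_adj G x A : is_derive_mx G x A ->
  is_derive_mx (fun s => (G s) ^t*) x (A ^t*).
Proof.
move=> GA i j; rewrite !mxE.
under eq_fun do rewrite !mxE; under [X in _ /\ is_derive _ _ X _]eq_fun do rewrite !mxE.
by apply: (@is_derive_complex_conj _ (fun s => G s j i)); exact: GA.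
Qed.

Lemma is_derive_mx_shift G x h A : is_derive_mx G (x + h) A ->
  is_derive_mx (fun s => G (s + h)) x A.
Proof.
by move=> GA i j; apply: (@is_derive_complex_shift _ (fun s => G s i j)); exact: GA.
Qed.

Lemma is_derive_mx_unique G x A B :
  is_derive_mx G x A -> is_derive_mx G x B -> A = B.
Proof.
move=> GA GB; apply/matrixP => i j.
exact: (@is_derive_complex_unique _ (fun s => G s i j) _ _ _ (GA i j) (GB i j)).
Qed.

Lemma is_derive_mx0_cst G x y : (forall s, is_derive_mx G s 0) -> G x = G y.
Proof.
move=> G0; apply/matrixP => i j.
apply: (@is_derive_complex0_cst _ (fun s => G s i j)) => s.
by have := G0 s i j; rewrite mxE.
Qed.

Lemma cvg_ninfty_mx_cst A B : cvg_ninfty_mx (fun=> A) B -> A = B.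
Proof.
move=> AB; apply/matrixP => i j; have [h1 h2] := AB i j; apply: complex_eq.
  exact: (cvg_unique (@norm_hausdorff _ R^o) (cvg_cst _) h1).
exact: (cvg_unique (@norm_hausdorff _ R^o) (cvg_cst _) h2).
Qed.

Lemma cvg_ninfty_mx_adj G A : cvg_ninfty_mx G A ->
  cvg_ninfty_mx (fun x => (G x) ^t*) (A ^t*).
Proof.
move=> GA i j; have [h1 h2] := GA j i; split.
  by rewrite !mxE complexReJ; under eq_fun do rewrite !mxE complexReJ.
rewrite !mxE complexImJ; under eq_fun do rewrite !mxE complexImJ; exact: cvgN.
Qed.

Lemma cvg_ninfty_mxM G H A B : cvg_ninfty_mx G A -> cvg_ninfty_mx H B ->
  cvg_ninfty_mx (fun x => G x *m H x) (A *m B).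
Proof.
move=> GA HB i j.
have Re_sum (F : 'I_n -> C) : complex.Re (\sum_k F k) = \sum_k complex.Re (F k).
  by apply: big_morph => // a b; exact: complexReD.
have Im_sum (F : 'I_n -> C) : complex.Im (\sum_k F k) = \sum_k complex.Im (F k).
  by apply: big_morph => // a b; exact: complexImD.
split.
  rewrite mxE Re_sum; under eq_fun do rewrite mxE Re_sum.
  apply: cvg_sum => k; have [h1 h2] := GA i k; have [h3 h4] := HB k j.
  rewrite complexReM; under eq_fun do rewrite complexReM.
  by apply: cvgB; apply: cvgM.
rewrite mxE Im_sum; under eq_fun do rewrite mxE Im_sum.
apply: cvg_sum => k; have [h1 h2] := GA i k; have [h3 h4] := HB k j.
rewrite complexImM; under eq_fun do rewrite complexImM.
by apply: cvgD; apply: cvgM.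
Qed.

Lemma cvg_ninfty_mx_shift G A h : cvg_ninfty_mx G A ->
  cvg_ninfty_mx (fun x => G (x + h)) A.
Proof.
move=> GA i j; have [h1 h2] := GA i j; split.
  exact: (cvg_comp _ _ (cvg_addrr_Ny h) h1).
exact: (cvg_comp _ _ (cvg_addrr_Ny h) h2).
Qed.

(** The derivative of [G H^*] is [G u H^* + G u^* H^* = 0]. *)
Lemma frame_mul_adj (u : R -> 'M[C]_n) G H :
  (forall x, skew_hermitian (u x)) ->
  (forall x, is_derive_mx G x (G x *m u x)) ->
  (forall x, is_derive_mx H x (H x *m u x)) ->
  cvg_ninfty_mx G 1%:M -> cvg_ninfty_mx H 1%:M ->
  forall x, G x *m (H x) ^t* = 1%:M.
Proof.
move=> skew Gu Hu G1 H1 x.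
have GH0 s : is_derive_mx (fun x => G x *m (H x) ^t*) s 0.
  have := is_derive_mxM (Gu s) (is_derive_mx_adj (Hu s)).
  rewrite adjmxM; have -> : (u s) ^t* = - u s := skew s.
  by rewrite mulNmx mulmxN mulmxA subrr.
have cst : (fun x => G x *m (H x) ^t*) = fun=> G x *m (H x) ^t*.
  by apply/funext => y; exact: is_derive_mx0_cst GH0.
apply: cvg_ninfty_mx_cst; rewrite -cst.
have := cvg_ninfty_mxM G1 (cvg_ninfty_mx_adj H1).
by rewrite trmx1 map_mx1 mulmx1.
Qed.

Lemma frame_unique (u : R -> 'M[C]_n) G H :
  (forall x, skew_hermitian (u x)) ->
  (forall x, is_derive_mx G x (G x *m u x)) ->
  (forall x, is_derive_mx H x (H x *m u x)) ->
  cvg_ninfty_mx G 1%:M -> cvg_ninfty_mx H 1%:M -> forall x, G x = H x.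
Proof.
move=> skew Gu Hu G1 H1 x.
rewrite -[LHS]mulmx1 -(mulmx1C (frame_mul_adj skew Hu Hu H1 H1 x)) mulmxA.
by rewrite (frame_mul_adj skew Gu Hu) // mul1mx.
Qed.

End Frames.

(** * The vacuum *)

Section Vacuum.
Local Open Scope classical_set_scope.
Local Open Scope sesquilinear_scope.
Variables (R : realType) (n : nat) (alpha : 'rV[R[i]]_n).
Local Notation C := R[i].
Local Notation a := (diag_mx alpha).
Implicit Types (l c : C) (x t h : R).

Lemma vacuum_frame g : flow_frame (@vacuum R n) g -> forall x t, g x t = 1%:M.
Proof.
move=> gF x t; have [_ g0 g1] := gF t.
apply: cvg_ninfty_mx_cst.
suff -> : (fun=> g x t) = (fun x : R => g x t) by [].
apply/funext => y; apply: (@is_derive_mx0_cst _ _ (fun s => g s t)) => s.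
by have := g0 s; rewrite mulmx0.
Qed.

Lemma vacuum_trivialization g E :
  flow_frame (@vacuum R n) g -> trivialization a (@vacuum R n) g E ->
  forall x t l, l != 0 ->
  E x t l = diag_mx (\row_j cexp (alpha 0 j * (l * x%:C%C + l^-1 * t%:C%C))).
Proof.
move=> gF triv x t l l0; have [Ex Et E0] := triv l l0.
apply/matrixP => i j.
have Ext : E x t l i j = E 0 t l i j * cexp (l * alpha 0 j * x%:C%C).
  rewrite -[in LHS](add0r x).
  apply: (@linear_ode _ (fun s => E s t l i j)) => s.
  have := Ex s t i j; rewrite addr0 -scalemxAr mxE mul_mx_diag mxE.
  by rewrite mulrCA.
have E0t : E 0 t l i j = E 0 0 l i j * cexp (l^-1 * alpha 0 j * t%:C%C).
  rewrite -[in LHS](add0r t).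
  apply: (@linear_ode _ (fun s => E 0 s l i j)) => s.
  have := Et 0 s i j; rewrite (vacuum_frame gF) invmx1 mul1mx mulmx1.
  by rewrite -scalemxAr mxE mul_mx_diag mxE mulrCA.
rewrite Ext E0t E0 !mxE -mulrA -cexpD mulr_natl.
have [->|_] := eqVneq i j; last by rewrite !mulr0n.
by rewrite !mulr1n; congr cexp; ring.
Qed.

(** [exp (a (l + 1/l) h)], the factor gained by the vacuum trivialization when
    [x] and [t] both advance by [h]. *)
Definition monodromy h l : 'M[C]_n :=
  diag_mx (\row_j cexp (alpha 0 j * (l + l^-1) * h%:C%C)).

Lemma vacuum_trivialization_shift g E :
  flow_frame (@vacuum R n) g -> trivialization a (@vacuum R n) g E ->
  forall h x t l, l != 0 -> E (x + h) (t + h) l = monodromy h l *m E x t l.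
Proof.
move=> gF triv h x t l l0.
rewrite !(vacuum_trivialization gF triv _ _ l0) mulmx_diag; congr diag_mx.
apply/rowP => j; rewrite !mxE -cexpD; congr cexp.
by rewrite !rmorphD /=; ring.
Qed.

Lemma monodromy_cvg h c (j : 'I_n) : c != 0 ->
  (cexp (alpha 0 j * (l + l^-1) * h%:C%C) : C^o) @[l --> (c : C^o)^'] -->
  (cexp (alpha 0 j * (c + c^-1) * h%:C%C) : C^o).
Proof.
move=> c0.
have lc : (l : C^o) @[l --> (c : C^o)^'] --> (c : C^o) by exact: cvg_within.
apply: cvg_cexp; apply: complex_cvgM; last exact: complex_cvg_cst.
apply: complex_cvgM; first exact: complex_cvg_cst.
exact: (complex_cvgD lc (complex_cvgV c0 lc)).
Qed.

(** Since [l + 1/l - c - 1/c = (l - c) (1 - 1/(l c))], the exponential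
    equals [cexp (b l * (l - c))] with [b] bounded near [c], so it differs from
    [1] by at most a constant times [`|l - c|]. *)
Lemma monodromy_quotient_bounded h c (j : 'I_n) : c != 0 ->
  cexp (alpha 0 j * (c + c^-1) * h%:C%C) = 1 ->
  eventually_bounded (c : C^o)^'
    (fun l => (cexp (alpha 0 j * (l + l^-1) * h%:C%C) - 1) / (l - c) : C^o).
Proof.
move=> c0 c1.
have lc : (l : C^o) @[l --> (c : C^o)^'] --> (c : C^o) by exact: cvg_within.
pose b l : C^o := alpha 0 j * h%:C%C * (1 - (l * c)^-1).
have bc : b l @[l --> (c : C^o)^'] --> b c.
  apply: complex_cvgM; first exact: complex_cvg_cst.
  apply: complex_cvgB; first exact: complex_cvg_cst.
  apply: complex_cvgV; first by rewrite mulf_neq0.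
  by apply: (complex_cvgM lc); exact: complex_cvg_cst.
have [M bM] := eventually_bounded_cvg bc.
have gc : (b l * (l - c) : C^o) @[l --> (c : C^o)^'] --> (0 : C^o).
  rewrite -(mulr0 (b c)) -(subrr c).
  by apply: (complex_cvgM bc); apply: (complex_cvgB lc); exact: complex_cvg_cst.
exists ((2 * expR 1)%:C%C * M).
have small : \forall l \near (c : C^o)^', `|0 - b l * (l - c)| < 1.
  by move/cvg_distP: gc; apply; exact: ltr01.
have l0 : \forall l \near (c : C^o)^', l != 0 := dnbhs_neq (c : C^o) 0.
have lc0 : \forall l \near (c : C^o)^', l != c := dnbhs_neq (c : C^o) c.
apply: filterS3 (filterI l0 lc0) bM small => l [ln0 lnc] bl.
rewrite sub0r normrN => /ltW gl.
have -> : cexp (alpha 0 j * (l + l^-1) * h%:C%C) = cexp (b l * (l - c)).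
  rewrite -[RHS]mulr1 -c1 -cexpD; congr cexp; rewrite /b.
  by field; rewrite c0 ln0.
rewrite normrM normfV ler_pdivrMr ?normr_gt0 ?subr_eq0 //.
apply: (le_trans (cexp_sub1_le gl)); rewrite -(mulrA _ M) normrM.
apply: ler_wpM2l; first by rewrite lecR mulr_ge0 // expR_ge0.
by apply: ler_wpM2r.
Qed.

End Vacuum.

(** * Dressing the vacuum *)

Section Dressing.
Local Open Scope classical_set_scope.
Local Open Scope sesquilinear_scope.
Variables (R : realType) (n : nat) (alpha : 'rV[R[i]]_n) (h : R).
Local Notation C := R[i].
Local Notation a := (diag_mx alpha).
Local Notation D := (monodromy alpha h).
Implicit Types (l c : C) (x t : R).

(** [d_resonant] makes the monodromy equal to [1] at the poles of [f], and
    [d_circle] transports this to the conjugate points. *)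
Variables (f : C -> 'M[C]_n) (N : 'M[{poly C}]_n) (d : {poly C}).
Hypothesis fE : reduced_fraction f N d.
Hypothesis f_unitary : forall l, ~~ root d l -> ~~ root d l^* ->
  (f l^*) ^t* *m f l = 1%:M.
Hypothesis d_simple : forall c, root d c -> (mup c d <= 1)%N.
Hypothesis d_disjoint : forall c, root d c -> ~~ root d c^*.
Hypothesis d_circle : forall c, root d c -> c^* = c^-1.
Hypothesis d_resonant : forall c j, root d c ->
  cexp (alpha 0 j * (c + c^-1) * h%:C%C) = 1.

Let cj := map_poly (Num.conj : C -> C).
(** The roots of [q] are the poles of [f] and of its inverse. *)
Let q := d * cj d.

Lemma simple_root_factor c : root d c ->
  exists2 e, d = e * ('X - c%:P) & ~~ root e c.
Proof.
move=> dc; have [e dE] := factor_theorem _ _ dc; exists e => //.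
apply/negP => /factor_theorem[e' eE].
have := d_simple dc; rewrite leqNgt => /negP; apply.
rewrite mup_geq ?(reduced_fraction_neq0 fE) //.
by rewrite dE eE -mulrA -expr2 dvdp_mull.
Qed.

Lemma denominator_neq0 : q != 0.
Proof. by rewrite mulf_neq0 ?map_poly_eq0 ?(reduced_fraction_neq0 fE). Qed.

Lemma denominator_factor c : root q c ->
  (exists2 e, q = e * ('X - c%:P) & e.[c] != 0) /\
  (forall j, cexp (alpha 0 j * (c + c^-1) * h%:C%C) = 1).
Proof.
rewrite rootM => /orP[dc|].
  split=> [|j]; last exact: d_resonant.
  have [e dE ec] := simple_root_factor dc.
  exists (e * cj d); first by rewrite /q {1}dE mulrAC.
  by rewrite -rootE rootM negb_or ec root_conj_poly d_disjoint.
rewrite root_conj_poly => dc; split => [|j].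
  have [e dE ec] := simple_root_factor dc.
  exists (d * cj e).
    rewrite /q {2}dE /cj rmorphM /= rmorphB /= map_polyX map_polyC /= conjCK.
    by rewrite mulrA.
  rewrite -rootE rootM negb_or root_conj_poly ec andbT.
  by have := d_disjoint dc; rewrite conjCK.
have := d_circle dc; rewrite conjCK => cE.
have cV : c^-1 = c^* by rewrite {1}cE invrK.
by have := d_resonant j dc; rewrite -cE -cV addrC.
Qed.

Definition conjugated_monodromy l := f l *m D l *m adjoint_loop f l.
Local Notation M := conjugated_monodromy.

Lemma loop_mul_adjoint l : ~~ root q l -> f l *m adjoint_loop f l = 1%:M /\
  adjoint_loop f l *m f l = 1%:M.
Proof.
rewrite rootM negb_or root_conj_poly => /andP[h1 h2].
have := f_unitary h1 h2; rewrite -/(adjoint_loop f l) => E; split=> //.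
exact: mulmx1C.
Qed.

Lemma polynomial_bounded (p : {poly C}) c : eventually_bounded (c : C^o)^'
  (fun l => p.[l] : C^o).
Proof.
apply: (@eventually_bounded_cvg _ _ _ _ _ p.[c]).
by apply: cvg_horner; exact: cvg_within.
Qed.

Lemma quotient_bounded c j : c != 0 -> eventually_bounded (c : C^o)^'
  (fun l => (cexp (alpha 0 j * (l + l^-1) * h%:C%C) - 1) / q.[l] : C^o).
Proof.
move=> c0; have [qc|qc] := boolP (root q c).
  have [[e qE ec] res] := denominator_factor qc.
  apply: (@eventually_bounded_near _ _ _ _ (fun l =>
     (cexp (alpha 0 j * (l + l^-1) * h%:C%C) - 1) / (l - c) * e.[l]^-1 : C^o)).
    by apply: filterE => l; rewrite qE hornerM hornerXsubC invfM mulrAC mulrA.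
  apply: eventually_boundedM; first exact: monodromy_quotient_bounded.
  apply: (@eventually_bounded_cvg _ _ _ _ _ e.[c]^-1).
  by apply: complex_cvgV; [exact: ec | apply: cvg_horner; exact: cvg_within].
apply: eventually_boundedM.
  apply: eventually_bounded_cvg; apply: complex_cvgB; first exact: monodromy_cvg.
  exact: complex_cvg_cst.
apply: (@eventually_bounded_cvg _ _ _ _ _ q.[c]^-1).
by apply: complex_cvgV; [exact: qc | apply: cvg_horner; exact: cvg_within].
Qed.

Lemma loop_entry l i j : ~~ root d l -> f l i j = (N i j).[l] / d.[l].
Proof. by case: fE => _ _ h1 /h1 ->; rewrite !mxE mulrC. Qed.

(** [M = 1 + f (D - 1) f^-1], and [D - 1] vanishes at the roots of the
    common denominator [q], all of them simple. *)
Lemma conjugated_monodromy_bounded c i j : c != 0 ->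
  eventually_bounded (c : C^o)^' (fun l => M l i j : C^o).
Proof.
move=> c0.
pose F k l : C^o := (N i k).[l] * (cj (N j k)).[l] *
  ((cexp (alpha 0 k * (l + l^-1) * h%:C%C) - 1) / q.[l]).
apply: (@eventually_bounded_near _ _ _ _ (fun l => \sum_k F k l + (i == j)%:R)).
  apply: filterS (near_nonroot c denominator_neq0) => l ql.
  have [ff _] := loop_mul_adjoint ql.
  have -> : M l = f l *m (D l - 1%:M) *m adjoint_loop f l + 1%:M.
    by rewrite mulmxBr mulmx1 mulmxBl ff subrK.
  rewrite [RHS]mxE [X in _ = _ + X]mxE; congr (_ + _).
  rewrite mxE; apply: eq_bigr => k _.
  rewrite /monodromy -diag_const_mx -raddfB /= mul_mx_diag !mxE.
  move: (ql); rewrite rootM negb_or root_conj_poly => /andP[h1 h2].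
  rewrite !loop_entry // rmorphM fmorphV /= /F !conj_horner /q hornerM conj_horner.
  by rewrite invfM; ring.
have [B FB] : eventually_bounded (c : C^o)^' (fun l => \sum_k F k l).
  apply: eventually_bounded_sum => k.
  apply: eventually_boundedM; last exact: quotient_bounded.
  by apply: eventually_boundedM; exact: polynomial_bounded.
exists (B + `|(i == j)%:R|); apply: filterS FB => l lB.
by rewrite (le_trans (ler_normD _ _)) // lerD2r.
Qed.

(** [1] is real, whence neither a pole of [f] nor the conjugate of one. *)
Lemma conjugated_monodromy_cvg1 i j :
  (M l i j : C^o) @[l --> (1 : C^o)^'] --> (M 1 i j : C^o).
Proof.
have d1 : ~~ root d 1.
  by apply/negP => r; have := d_disjoint r; rewrite conjC1 r.
have f1 k m : (f l k m : C^o) @[l --> (1 : C^o)^'] --> (f 1 k m : C^o).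
  rewrite (loop_entry _ _ d1).
  apply: (@cvg_trans _ (((N k m).[l] / d.[l] : C^o) @[l --> (1 : C^o)^'])).
    apply: near_eq_cvg.
    apply: filterS (near_nonroot (1 : C) (reduced_fraction_neq0 fE)) => l dl.
    by rewrite loop_entry.
  apply: complex_cvgM; first by apply: cvg_horner; exact: cvg_within.
  by apply: complex_cvgV; [exact: d1 | apply: cvg_horner; exact: cvg_within].
have f1c k m : (f l^* k m : C^o) @[l --> (1 : C^o)^'] --> (f 1 k m : C^o).
  have cj1 : (Num.conj : C -> C) @ (1 : C^o)^' --> (1 : C^o)^'.
    by have := @cvg_conj_dnbhs C 1; rewrite conjC1.
  exact: (cvg_comp _ _ cj1 (f1 k m)).
rewrite mxE.
under eq_fun do rewrite mxE.
apply: cvg_sum => k; apply: complex_cvgM.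
  rewrite /monodromy mul_mx_diag mxE; under eq_fun do rewrite mul_mx_diag mxE.
  apply: complex_cvgM; first exact: f1.
  rewrite mxE; under eq_fun do rewrite mxE.
  exact: monodromy_cvg (oner_neq0 _).
rewrite !mxE conjC1; under eq_fun do rewrite !mxE.
exact: cvg_conj (f1c _ _).
Qed.

Lemma holomorphic_cvg (F : C -> 'M[C]_n) c i j : holomorphic_mx_at F c ->
  (F l i j : C^o) @[l --> (c : C^o)^'] --> (F c i j : C^o).
Proof.
move=> /(_ i j) hF.
have /derivable1_diffP/differentiable_continuous Fc := hF.
by move=> P /Fc FP; exact: (@nbhs_dnbhs C^o c _ FP).
Qed.

Lemma holomorphic_bounded (F : C -> 'M[C]_n) c i j : holomorphic_mx_at F c ->
  eventually_bounded (c : C^o)^' (fun l => F l i j : C^o).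
Proof. by move=> /holomorphic_cvg Fc; apply: eventually_bounded_cvg; exact: Fc. Qed.

Lemma holomorphic_adjoint_bounded (F : C -> 'M[C]_n) c i j :
  holomorphic_mx_at F c^* ->
  eventually_bounded (c : C^o)^' (fun l => adjoint_loop F l i j : C^o).
Proof.
move=> /holomorphic_cvg Fc; rewrite /adjoint_loop.
under eq_fun do rewrite !mxE.
apply: eventually_bounded_cvg; apply: (@cvg_conj C).
exact: (cvg_comp _ _ (@cvg_conj_dnbhs C c) (Fc j i)).
Qed.

Lemma mulmx_bounded (A B : C -> 'M[C]_n) c :
  (forall i j, eventually_bounded (c : C^o)^' (fun l => A l i j : C^o)) ->
  (forall i j, eventually_bounded (c : C^o)^' (fun l => B l i j : C^o)) ->
  forall i j, eventually_bounded (c : C^o)^' (fun l => (A l *m B l) i j : C^o).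
Proof.
move=> hA hB i j; under eq_fun do rewrite mxE.
by apply: eventually_bounded_sum => k; exact: eventually_boundedM.
Qed.

(** [W1] and [W2] stand for the vacuum trivialization at [(x,t)] and at the
    shifted point, with factorizations [f W1 = E1 f1] and [f W2 = E2 f2]. *)
Section Factorization.
Variables (E1 E2 f1 f2 W1 W2 : C -> 'M[C]_n).
Hypothesis W12 : forall l, l != 0 -> W2 l = D l *m W1 l.
Hypothesis f1_loop : rational_loop f1.
Hypothesis f2_loop : rational_loop f2.
Hypothesis fW1 : forall l, l != 0 -> ~ is_pole f l -> ~ is_pole f1 l ->
  f l *m W1 l = E1 l *m f1 l.
Hypothesis fW2 : forall l, l != 0 -> ~ is_pole f l -> ~ is_pole f2 l ->
  f l *m W2 l = E2 l *m f2 l.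
Hypothesis E1_holo : forall l, l != 0 -> holomorphic_mx_at E1 l.
Hypothesis E2_holo : forall l, l != 0 -> holomorphic_mx_at E2 l.
Hypothesis E2_unitary : forall l, l != 0 -> (E2 l^*) ^t* *m E2 l = 1%:M.

Lemma loop_conjugation l : l != 0 -> ~~ root q l ->
  ~ is_pole f1 l -> ~ is_pole f2 l -> M l *m E1 l *m f1 l = E2 l *m f2 l.
Proof.
move=> l0 ql p1 p2.
have [_ ff] := loop_mul_adjoint ql.
have pf : ~ is_pole f l.
  rewrite (is_pole_root l fE); apply/negP.
  by move: ql; rewrite rootM negb_or => /andP[].
rewrite -fW2 // W12 // -mulmxA -fW1 // /conjugated_monodromy.
by rewrite -!mulmxA [adjoint_loop f l *m _]mulmxA ff mul1mx.
Qed.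

Lemma near_loop (F : C -> 'M[C]_n) c : rational_loop F ->
  \forall l \near (c : C^o)^', ~ is_pole F l /\ F l *m adjoint_loop F l = 1%:M.
Proof.
move=> [[N1 [d1 r1]] _ _ unit1].
have q1 : d1 * cj d1 != 0 by rewrite mulf_neq0 ?map_poly_eq0 ?(reduced_fraction_neq0 r1).
apply: filterS (near_nonroot c q1) => l.
rewrite rootM negb_or root_conj_poly => /andP[/negP h1 /negP h2].
have p1 : ~ is_pole F l by rewrite (is_pole_root l r1).
split; [exact: p1 | apply: mulmx1C; apply: unit1; first exact: p1].
by rewrite (is_pole_root _ r1).
Qed.

(** Near [c <> 0] the quotient [f2 f1^-1] is [E2^-1 M E1], a product of
    bounded factors. *)
Lemma factorization_bounded c i j : c != 0 -> eventually_bounded (c : C^o)^'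
  (fun l => (f2 l *m adjoint_loop f1 l) i j : C^o).
Proof.
move=> c0.
have l0 : \forall l \near (c : C^o)^', l != 0 := dnbhs_neq (c : C^o) 0.
have near1 := near_loop c f1_loop; have near2 := near_loop c f2_loop.
have near0 := near_nonroot c denominator_neq0.
apply: (@eventually_bounded_near _ _ _ _
    (fun l => (adjoint_loop E2 l *m (M l *m E1 l)) i j : C^o)).
  near=> l.
  have ln0 : l != 0 by near: l.
  have ql : ~~ root q l by near: l.
  have [p1 ff1] : ~ is_pole f1 l /\ f1 l *m adjoint_loop f1 l = 1%:M by near: l.
  have [p2 _] : ~ is_pole f2 l /\ f2 l *m adjoint_loop f2 l = 1%:M by near: l.
  rewrite -[in LHS](mulmx1 (E1 l)) -ff1 [E1 l *m _]mulmxA.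
  rewrite (mulmxA (M l)) (mulmxA (M l)) loop_conjugation // -mulmxA mulmxA.
  by rewrite /adjoint_loop E2_unitary // mul1mx.
apply: mulmx_bounded => {}i {}j.
  by apply: holomorphic_adjoint_bounded; apply: E2_holo; rewrite conjC_eq0.
apply: mulmx_bounded => {}i {}j; first exact: conjugated_monodromy_bounded.
by apply: holomorphic_bounded; exact: E1_holo.
Unshelve. all: by end_near. Qed.

(** [E2] and [M E1] agree off the poles of the loops, which may vary with
    [(x,t)]; continuity gives the equality at the fixed point [1], where it can
    be differentiated in [x]. *)
Lemma factorization_shift : E2 1 = M 1 *m E1 1.
Proof.
have [e e0 eP] := loop_eq_of_bounded f1_loop f2_loop
  (fun c nz i j => factorization_bounded i j nz).
have l0 : \forall l \near (1 : C^o)^', l != 0 := dnbhs_neq (1 : C^o) 0.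
have near0 := near_nonroot (1 : C) denominator_neq0.
have neare := near_nonroot (1 : C) e0.
have E2l : \forall l \near (1 : C^o)^', E2 l = M l *m E1 l.
  apply: filterS3 l0 near0 neare => l ln0 ql /eP[f21 p1 p2 u1].
  have := loop_conjugation ln0 ql p1 p2.
  by rewrite f21 => /(congr1 (mulmx^~ (invmx (f1 l)))); rewrite !mulmxK.
apply/matrixP => i j; rewrite mxE.
have lim1 := @holomorphic_cvg _ _ i j (E2_holo (oner_neq0 _)).
have lim2 : (\sum_k M l i k * E1 l k j : C^o) @[l --> (1 : C^o)^'] -->
    (\sum_k M 1 i k * E1 1 k j : C^o).
  apply: (@cvg_sum C) => k; apply: complex_cvgM; first exact: conjugated_monodromy_cvg1.
  exact: holomorphic_cvg (E1_holo (oner_neq0 _)).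
apply: (cvg_unique (@norm_hausdorff _ C^o) lim1).
apply: cvg_trans lim2; apply: near_eq_cvg.
by apply: filterS E2l => l ->; rewrite mxE.
Qed.

End Factorization.

Variables (u : R -> R -> 'M[C]_n).
Hypothesis u_soliton : soliton a f u.
Hypothesis a_skew : skew_hermitian a.

(** Differentiate in [x], at [l = 1], the identity [E'(shift) = M E'] and the
    unitarity of [E']. *)
Lemma soliton_shift_and_skew :
  (forall x t, u (x + h) (t + h) = u x t) /\ (forall x t, skew_hermitian (u x t)).
Proof.
have [g [E [E' [f' [flow triv loop [fact holo unitary E'x]]]]]] := u_soliton.
have [_ _ gF _] := flow.
have n1 : (1 : C) != 0 := oner_neq0 _.
have shift x t : E' (x + h) (t + h) 1 = M 1 *m E' x t 1.
  apply: (@factorization_shift (E' x t) (E' (x + h) (t + h)) (f' x t)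
    (f' (x + h) (t + h)) (E x t) (E (x + h) (t + h))) => //.
  - by move=> l l0; exact: vacuum_trivialization_shift gF triv _ _ _ _ l0.
  - by move=> l l0 p1 p2; exact: fact.
  - by move=> l l0 p1 p2; exact: fact.
  - by move=> l l0; case: (holo x t l l0).
  - by move=> l l0; case: (holo (x + h) (t + h) l l0).
  - by move=> l l0; exact: unitary.
split=> x t.
  have D1 : is_derive_mx (fun s => E' (s + h) (t + h) 1) x
      (E' (x + h) (t + h) 1 *m (1 *: a + u (x + h) (t + h))).
    exact: (@is_derive_mx_shift _ _ (fun s => E' s (t + h) 1) _ _ _ (E'x _ _ 1 n1)).
  have D2 : is_derive_mx (fun s => E' (s + h) (t + h) 1) x
      (E' (x + h) (t + h) 1 *m (1 *: a + u x t)).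
    rewrite shift -mulmxA; under eq_fun do rewrite shift.
    have := is_derive_mxM (is_derive_mx_cst (M 1) x) (E'x x t 1 n1).
    by rewrite mul0mx add0r.
  have := is_derive_mx_unique D1 D2.
  have [_ U] := holo (x + h) (t + h) 1 n1.
  by move=> /(congr1 (mulmx (invmx (E' (x + h) (t + h) 1)))); rewrite !mulKmx // => /addrI.
have un s : (E' s t 1) ^t* *m E' s t 1 = 1%:M.
  by have := unitary s t 1 n1; rewrite conjC1.
have D1 := is_derive_mxM (is_derive_mx_adj (E'x x t 1 n1)) (E'x x t 1 n1).
have D0 := is_derive_mx_cst (1%:M : 'M[C]_n) x.
have : is_derive_mx (fun s => (E' s t 1) ^t* *m E' s t 1) x 0.
  by under eq_fun do rewrite un.
move=> /(is_derive_mx_unique D1).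
rewrite adjmxM mulmxA un mul1mx -mulmxA un mulmx1 scale1r => E0.
have := a_skew; rewrite /skew_hermitian => aE; apply/eqP; rewrite -addr_eq0 -E0.
by rewrite linearD /= map_mxD aE addrACA addNr add0r.
Qed.

End Dressing.

(** * Periodicity *)

Section Periodicity.
Local Open Scope sesquilinear_scope.
Variables (R : realType) (n k : nat).
Local Notation C := R[i].
Implicit Types (theta tau : R) (z c l : C).

Lemma expi_conj theta : (expi theta)^* = (expi theta)^-1.
Proof.
have e1 : expi theta * (expi theta)^* = 1.
  by rewrite -normCK normc_def /= cos2Dsin2 sqrtr1 expr1n.
have e0 : expi theta != 0.
  by apply: contra_eq_neq e1 => ->; rewrite mul0r eq_sym oner_neq0.
by rewrite -[LHS](mulKf e0) e1 mulr1.
Qed.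

(** The exponent is [b * (2 cos theta) * (tau / 2) = b * 2 pi m]. *)
Lemma cexp_resonance theta tau (m : int) (b : C) : cos theta != 0 ->
  tau = 2 * pi * m%:~R / cos theta -> b = 'i \/ b = - 'i ->
  cexp (b * (expi theta + (expi theta)^-1) * (tau / 2)%:C%C) = 1.
Proof.
move=> c0 tauE bi.
have -> : expi theta + (expi theta)^-1 = (2 * cos theta)%:C%C.
  by rewrite -expi_conj; apply: complex_eq; rewrite /expi /=; ring.
rewrite -mulrA -rmorphM /=.
have -> : 2 * cos theta * (tau / 2) = 2 * pi * m%:~R by rewrite tauE; field.
rewrite mulrC; case: bi => ->; first exact: cexp_2pi.
rewrite mulrN -mulNr -rmorphN /= -mulrN -mulrNz.
exact: cexp_2pi.
Qed.

Lemma diag_i_skew : skew_hermitian (diag_i R n k).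
Proof.
apply/matrixP => i j; rewrite !mxE eq_sym rmorphMn /= -mulNrn.
have [->|] := eqVneq i j; last by rewrite !mulr0n.
by case: ifP => _; rewrite ?complexiE ?rmorphN /= conjCi.
Qed.

Lemma shift_invariant_periodic (u : R -> R -> 'M[C]_n) tau :
  (forall x t, u (x + tau / 2) (t + tau / 2) = u x t) ->
  (forall x t, skew_hermitian (u x t)) -> periodic_solution u tau.
Proof.
move=> u_shift skew.
have periodic (V : Type) (w : R -> R -> V) :
    (forall x t, w (x + tau / 2) (t + tau / 2) = w x t) -> time_periodic w tau.
  move=> w_shift X T; rewrite /spacetime -(w_shift ((X + T) / 2)).
  by congr w; field.
split=> [|g gF]; first exact: periodic.
apply: periodic => x t.
have [_ gu g1] := gF t; have [_ gu' g1'] := gF (t + tau / 2).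
apply: (@frame_unique _ _ (fun x => u x t) (fun x => g (x + tau / 2) (t + tau / 2))
  (fun x => g x t)) => //.
  move=> y; rewrite -u_shift.
  exact: (@is_derive_mx_shift _ _ (fun s => g s (t + tau / 2)) _ _ _ (gu' _)).
exact: (@cvg_ninfty_mx_shift _ _ (fun s => g s (t + tau / 2)) _ _ g1').
Qed.

(** Stated through a reduced fraction and the position and order of its poles,
    so that it applies to the simple elements, whose poles are explicit, as well
    as to general loops. *)
Lemma loop_soliton_periodic f (N : 'M[{poly C}]_n) d u tau :
  reduced_fraction f N d ->
  (forall l, ~~ root d l -> ~~ root d l^* -> (f l^*) ^t* *m f l = 1%:M) ->
  (forall c, root d c -> (mup c d <= 1)%N) ->
  (forall c, root d c -> ~~ root d c^*) ->
  (forall c, root d c -> exists theta (m : int),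
     [/\ c = expi theta, cos theta != 0 & tau = 2 * pi * m%:~R / cos theta]) ->
  soliton (diag_i R n k) f u -> periodic_solution u tau.
Proof.
move=> fE unit simple disj res sol.
have [] := @soliton_shift_and_skew _ _ _ (tau / 2) _ _ _ fE unit simple disj _ _ u sol
  diag_i_skew; last exact: shift_invariant_periodic.
  by move=> c /res[theta [m [-> _ _]]]; exact: expi_conj.
move=> c j /res[theta [m [-> c0 tauE]]]; apply: cexp_resonance c0 tauE _.
by rewrite mxE; case: ifP => _; [left; rewrite complexiE | right].
Qed.

Lemma simple_element1 z l : simple_element z (1%:M : 'M[C]_n) l = 1%:M.
Proof. by rewrite /simple_element subrr scaler0 addr0. Qed.

Lemma simple_element_unitary z (p : 'M[C]_n) l : hermitian_projection p ->
  l != z -> l != z^* -> (simple_element z p l^*) ^t* *m simple_element z p l = 1%:M.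
Proof.
move=> [pH pp] lz lzc.
have qH : (1%:M - p) ^t* = 1%:M - p.
  by rewrite linearB /= map_mxB pH trmx1 map_mx1.
have pq : p *m (1%:M - p) = 0 by rewrite mulmxBr mulmx1 pp subrr.
have qp : (1%:M - p) *m p = 0 by rewrite mulmxBl mul1mx pp subrr.
have qq : (1%:M - p) *m (1%:M - p) = 1%:M - p.
  by rewrite mulmxBl mul1mx pq subr0.
have adjE (A B : 'M[C]_n) b : (A + b *: B) ^t* = A ^t* + b^* *: B ^t*.
  by apply/matrixP => i j; rewrite !mxE rmorphD rmorphM.
rewrite /simple_element adjE pH qH.
rewrite mulmxDl !mulmxDr -!scalemxAl -!scalemxAr pp pq qp qq !scaler0 addr0 add0r.
rewrite scalerA rmorphM fmorphV !rmorphB /= !conjCK.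
rewrite (_ : _ * _ = 1); first by rewrite scale1r addrC subrK.
by field; rewrite !subr_eq0 lz lzc.
Qed.

(** At the only root [z^*] of the denominator, the numerator is
    [(z^* - z) (1 - p)]. *)
Lemma simple_element_reduced z (p : 'M[C]_n) : z^* != z -> p != 1%:M ->
  reduced_fraction (simple_element z p)
    (\matrix_(i, j) (('X - (z^*)%:P) * (p i j)%:P +
                     ('X - z%:P) * ((1%:M - p) i j)%:P))
    ('X - (z^*)%:P).
Proof.
move=> zz p1; split; first exact: monicXsubC.
  move=> l; rewrite root_XsubC => /eqP ->.
  have [i [j ij]] : exists i j, (1%:M - p) i j != 0.
    have : 1%:M - p != 0 by rewrite subr_eq0 eq_sym.
    apply: contra_neqP => h; apply/matrixP => i j; rewrite [RHS]mxE.
    by apply/eqP/negPn/negP => ij; apply: h; exists i, j.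
  exists i, j; rewrite mxE hornerD !hornerM !hornerXsubC subrr mul0r add0r !hornerC.
  by rewrite mulf_neq0 // subr_eq0.
move=> l; rewrite root_XsubC => lz.
apply/matrixP => i j; rewrite !mxE !hornerE.
by field; rewrite subr_eq0.
Qed.

Lemma simple_element1_reduced z :
  reduced_fraction (simple_element z (1%:M : 'M[C]_n)) 1%:M 1.
Proof.
split; first exact: monic1; first by move=> l; rewrite rootE hornerE oner_eq0.
move=> l _; rewrite simple_element1; apply/matrixP => i j.
by rewrite !mxE hornerC invr1 mul1r hornerMn hornerC.
Qed.

End Periodicity.

Unset Implicit Arguments.

Theorem mainTheorem15 (R : realType) (n k : nat) (hk : (0 < k < n)%N) :
  (forall (theta : R) (p : 'M[R[i]]_n) (u : R -> R -> 'M[R[i]]_n),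
     expi theta \isn't Num.real ->
     cos theta != 0 ->
     hermitian_projection p ->
     soliton (diag_i R n k) (simple_element (expi theta) p) u ->
     periodic_solution u (2 * pi / cos theta))
  /\
  (forall (r : nat) (theta : 'I_r -> R) (f : R[i] -> 'M[R[i]]_n)
          (u : R -> R -> 'M[R[i]]_n) (tau : R),
     rational_loop f ->
     (forall j, expi (theta j) \isn't Num.real) ->
     (forall j, cos (theta j) != 0) ->
     (forall q, is_pole f q <-> exists j, q = expi (theta j)) ->
     (forall j, simple_pole f (expi (theta j))) ->
     (forall i j, expi (theta i) <> (expi (theta j))^*) ->
     soliton (diag_i R n k) f u ->
     (exists m : 'I_r -> int,
        forall j, tau = 2 * pi * (m j)%:~R / cos (theta j)) ->
     periodic_solution u tau).
Proof.
split=> [theta p u nonreal c0 hp|r theta f u tau [[N [d fE]] _ _ unit] nonreal c0 polesE simple disj sol [m tauE]].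
  have zz : (expi theta)^* != expi theta by apply: contra nonreal => /eqP/CrealP.
  have [->|p1] := eqVneq p 1%:M.
    apply: (loop_soliton_periodic (simple_element1_reduced n (expi theta))).
    - by move=> l _ _; rewrite !simple_element1 trmx1 map_mx1 mulmx1.
    - by move=> c; rewrite rootE hornerE oner_eq0.
    - by move=> c; rewrite rootE hornerE oner_eq0.
    - by move=> c; rewrite rootE hornerE oner_eq0.
  apply: (loop_soliton_periodic (simple_element_reduced zz p1)).
  - move=> l; rewrite !root_XsubC (inj_eq (can_inj (@conjCK _))) => h1 h2.
    exact: simple_element_unitary.
  - by move=> c _; rewrite -['X - _]expr1 mup_XsubCX; case: eqP.
  - by move=> c; rewrite !root_XsubC => /eqP ->; rewrite conjCK eq_sym.
  (* The pole is z^* = exp (- i theta), with the same cosine. *)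
  - move=> c; rewrite root_XsubC => /eqP ->; exists (- theta), 1.
    rewrite cosN mulr1; split=> //.
    by rewrite /expi cosN sinN.
have polesd c : root d c -> exists j, c = expi (theta j).
  by move=> dc; apply/polesE/(is_pole_root c fE).
apply: (loop_soliton_periodic fE) sol.
- move=> l /negP h1 /negP h2.
  by apply: unit; rewrite (is_pole_root _ fE).
- move=> c /polesd[j ->]; have [N' [d' [fE' m1]]] := simple j.
  by rewrite (reduced_fraction_mup _ fE fE') m1.
- move=> c /polesd[i ci]; apply/negP => /polesd[j cj].
  by apply: (disj i j); rewrite -ci -cj conjCK.
- move=> c /polesd[j ->]; exists (theta j), (m j); split=> //.
Qed.
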